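(* For every $r,t\in \mathbb{N}$, there exists $C(r,t)>0$ such that for all sufficiently large $n$ (depending on $r$ and $t$), any $r$-edge colouring of the complete graph on $n$ vertices with the property that each of the $r$ colours appears on at least $C(r,t)\,n^{2-1/t}$ edges must contain an $(r,t)$-unavoidable graph (as an edge-coloured complete subgraph).
   Context: Let $G$ be a complete graph whose vertices and edges are coloured with $r$ colours. $G$ is an $r$-minimal graph if all $r$ colours are present in $G$ (each colour appears on at least one vertex or edge) and no proper induced subgraph of $G$ contains all $r$ colours. The $t$-blowup of a vertex- and edge-coloured complete graph $G$ is the edge-coloured complete graph obtained by replacing each vertex of $G$ by a clique of order $t$ all of whose edges receive the colour of that vertex, and replacing each edge of $G$ by a complete bipartite graph $K_{t,t}$ between the corresponding cliques, all of whose edges receive the colour of that edge. An edge-coloured clique is $(r,t)$-unavoidable if it is a $t$-blowup of some $r$-minimal graph. *)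

(* Defs.v *)
From mathcomp Require Import all_boot.

Set Implicit Arguments.
Unset Strict Implicit.
Unset Printing Implicit Defensive.

(* Edge colouring of the complete graph on V.  Only the values at distinct
   vertices are meaningful; the diagonal values are ignored everywhere. *)
Record edge_colouring (r : nat) (V : finType) := EdgeColouring {
  ecol :> V -> V -> 'I_r;
  ecolC : forall x y, ecol x y = ecol y x
}.

Record coloured_graph (r : nat) (V : finType) := ColouredGraph {
  vcol : V -> 'I_r;
  edges_of : edge_colouring r V
}.

Definition colour_class (r : nat) (V : finType) (e : edge_colouring r V)
    (c : 'I_r) : {set {set V}} :=
  [set [set p.1; p.2] | p : V * V & (p.1 != p.2) && (e p.1 p.2 == c)].

Definition appears_on (r : nat) (V : finType) (G : coloured_graph r V)
    (S : {set V}) (c : 'I_r) : Prop :=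
  (exists2 x, x \in S & vcol G x = c) \/
  (exists x y, [/\ x \in S, y \in S, x != y & edges_of G x y = c]).

Definition has_all_colours (r : nat) (V : finType) (G : coloured_graph r V)
    (S : {set V}) : Prop :=
  forall c : 'I_r, appears_on G S c.

Definition r_minimal (r : nat) (V : finType) (G : coloured_graph r V) : Prop :=
  has_all_colours G [set: V] /\
  (forall S : {set V}, S \proper [set: V] -> ~ has_all_colours G S).

Definition blowup_col (r t : nat) (V : finType) (G : coloured_graph r V)
    (u v : V * 'I_t) : 'I_r :=
  if u.1 == v.1 then vcol G u.1 else edges_of G u.1 v.1.

Lemma blowup_colC (r t : nat) (V : finType) (G : coloured_graph r V)
    (u v : V * 'I_t) : blowup_col G u v = blowup_col G v u.
Proof.
by rewrite /blowup_col eq_sym; case: eqP => [->|_] //; exact: ecolC.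
Qed.

Definition blowup (r t : nat) (V : finType) (G : coloured_graph r V) :
    edge_colouring r (V * 'I_t)%type :=
  EdgeColouring (@blowup_colC r t V G).

Definition preserves_colours (r : nat) (W V : finType)
    (h : edge_colouring r W) (e : edge_colouring r V) (f : W -> V) : Prop :=
  forall x y, x != y -> e (f x) (f y) = h x y.

Definition isomorphic (r : nat) (W V : finType)
    (h : edge_colouring r W) (e : edge_colouring r V) : Prop :=
  exists f : W -> V, bijective f /\ preserves_colours h e f.

Definition contains (r : nat) (V W : finType)
    (e : edge_colouring r V) (h : edge_colouring r W) : Prop :=
  exists f : W -> V, injective f /\ preserves_colours h e f.

Definition unavoidable (r t : nat) (W : finType) (h : edge_colouring r W) :
    Prop :=
  exists (V : finType) (G : coloured_graph r V),
    r_minimal G /\ isomorphic h (blowup t G).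

(* Main.v *)
Require Import Defs.
From mathcomp Require Import all_boot all_order all_algebra.
From mathcomp Require Import boolp reals exp.

(** Each colour [c] is dense enough for dependent random choice: the
    common [c]-neighbourhood of suitable [t] vertices contains a set [U_c] of
    large constant size all of whose [t]-tuples have at least [M] common
    [c]-neighbours, [M] being a large constant ([dependent_random_choice]).  Here the exponent [2 - 1/t] is
    exactly what makes the expected number of common neighbours of a random
    [t]-tuple a large constant.

    Choosing a monochromatic [t]-set [A_c] in [U_c] and then a monochromatic
    [t]-set [B_c] among its common neighbours would give one pair of cliques
    joined in colour [c]. All these choices have to be compatible with each
    other for the different colours. The difficulty is that a bound on the
    common neighbourhoods is known for [t] vertices only, so [A_c] cannot be
    shrunk once [B_c] depends on it. The remedy is to make the choice for
    every [t]-sequence [s] in [U_c] simultaneously: pigeonhole gives a set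
    [B_(c,s)] of common neighbours of [s] to which each vertex of each [U_d]
    is joined in a single colour. Ramsey's theorem for [t+1]-sequences
    ([ramsey]) yields a set of indices on which that colour, for a vertex
    preceding or following all of [s], depends only on [c], on [d] and on
    which of the two is the case. Picking the [A_c] as consecutive blocks of
    this set, and then applying Ramsey's theorem to the sets [B_c] belonging
    to them, gives [2r] disjoint monochromatic [t]-cliques, every two of which
    are joined in one colour, and such that each colour joins some two of them
    ([homogeneous_family]).

    These cliques form the [t]-blowup of a coloured complete graph on [2r]
    vertices in which all colours appear; an inclusion-minimal set of its
    vertices on which all colours still appear spans an [r]-minimal graph
    ([unavoidable_of_family]). *)

Set Implicit Arguments.
Unset Strict Implicit.
Unset Printing Implicit Defensive.

Import Order.TTheory GRing.Theory Num.Theory.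

(** * Pigeonhole and Ramsey's theorem for sequences *)

Lemma pigeonhole (T : Type) (K : finType) (f : T -> K) (s : seq T) h :
  #|K| * h < size s -> exists k, h < count (fun x => f x == k) s.
Proof.
move=> lt_s; apply/existsP; apply: contraLR lt_s; rewrite negb_exists -leqNgt.
move=> /forallP le_h; rewrite -sum1_size (partition_big f xpredT) //=.
rewrite -sum_nat_const; apply: leq_sum => k _.
by rewrite sum1_count leqNgt le_h.
Qed.

Lemma pigeonhole_set (V K : finType) (f : V -> K) (A : {set V}) h :
  #|K| * h < #|A| -> exists k, h < #|[set x in A | f x == k]|.
Proof.
rewrite cardE => /(pigeonhole f)[k lt_h]; exists k.
rewrite (leq_trans lt_h) // -size_filter.
rewrite -(card_uniqP (filter_uniq _ (enum_uniq _))).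
apply: subset_leq_card; apply/subsetP => x.
by rewrite mem_filter mem_enum inE andbC.
Qed.

Lemma inj_ord_of_card (V : finType) (A : {set V}) m :
  m <= #|A| -> exists2 b : 'I_m -> V, injective b & forall i, b i \in A.
Proof.
move=> le_m; exists (fun i => enum_val (widen_ord le_m i)); last first.
  by move=> i; apply: enum_valP.
by move=> i j /enum_val_inj /(congr1 val) /= /val_inj.
Qed.

Lemma subseq_nth2 (T : eqType) (x0 : T) (s : seq T) i j :
  i < j < size s -> subseq [:: nth x0 s i; nth x0 s j] s.
Proof.
move=> /andP[lt_ij lt_j]; rewrite -[X in subseq _ X](cat_take_drop j).
rewrite -cat1s cat_subseq // sub1seq; last first.
  by rewrite (drop_nth x0) ?mem_head.
by rewrite -(nth_take x0 lt_ij) mem_nth // size_takel // ltnW.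
Qed.

Definition constant_on_subseqs (T : eqType) (K : Type) (k : nat)
    (f : seq T -> K) (s : seq T) :=
  exists c, forall s', subseq s' s -> size s' = k -> f s' = c.

(** The colour of a subsequence is stored next to its first entry, and is not
    a function of that entry, because an element that occurs several times in
    the sequence may carry several colours. *)
Fixpoint head_determined (T : eqType) (K : Type) (k : nat)
    (f : seq T -> K) (s : seq (T * K)) : Prop :=
  if s is (x, c) :: s' then
    (forall y, subseq y (unzip1 s') -> size y = k -> f (x :: y) = c)
    /\ head_determined k f s'
  else True.

Lemma head_determined_filter (T K : eqType) k (f : seq T -> K) s c :
  head_determined k f s ->
  forall y, subseq y (unzip1 [seq p <- s | p.2 == c]) -> size y = k.+1 ->
    f y = c.
Proof.
elim: s => [_ y|[x d] s IHs /= [fx hd_s] y].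
  by rewrite subseq0 => /eqP->.
case: eqP => [dc|_] /=; last exact: IHs.
case: y => [|z y] //=; case: eqP => [->|_] sub_y sz_y; last exact: IHs.
have sub_y' : subseq y (unzip1 s).
  by apply: subseq_trans sub_y _; apply: map_subseq; apply: filter_subseq.
by case: sz_y => sz_y; rewrite fx.
Qed.

(** Ramsey's theorem for [k]-uniform hypergraphs.  The vertices are the entries
    of a sequence and the hyperedges its subsequences of length [k], so that
    the order of the vertices is available to the colouring [f].  This is the
    argument of Erdos and Rado: the induction hypothesis for [k], applied
    repeatedly to the colourings [f (x :: _)], produces a long sequence in
    which the colour of a subsequence depends on its first entry only; then
    the pigeonhole principle applies to the first entries. *)
Lemma ramsey k : forall (K : finType) h, exists N,
  forall (T : eqType) (X : seq T) (f : seq T -> K), N <= size X ->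
  exists H, [/\ subseq H X, size H = h & constant_on_subseqs k f H].
Proof.
elim: k => [|k IHk] K h.
  exists h => T X f le_h; exists (take h X); split; first exact: take_subseq.
    by rewrite size_takel.
  by exists (f [::]) => s _ /size0nil ->.
have [P prehom]: exists P, forall (T : eqType) (X : seq T) (f : seq T -> K),
    P <= size X -> exists Y : seq (T * K),
      [/\ subseq (unzip1 Y) X, size Y = (#|K| * h).+1 & head_determined k f Y].
  elim: (_.+1) => [|n [P IHn]].
    by exists 0 => T X f _; exists [::]; rewrite sub0seq.
  have [Q ramQ] := IHk K P.
  exists Q.+1 => T -[|x X] f //= le_Q.
  have [X' [sX' szX' [c fc]]] := ramQ T X (fun s => f (x :: s)) le_Q.
  have [|Y [sY szY hdY]] := IHn T X' f; first by rewrite szX'.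
  exists ((x, c) :: Y); split=> /=.
  - by rewrite eqxx (subseq_trans sY sX').
  - by rewrite szY.
  - split=> // y sy szy; apply: fc => //; exact: subseq_trans sY.
exists P => T X f le_P.
have [Y [sY szY hdY]] := prehom T X f le_P.
have [|c] := @pigeonhole _ K snd Y h; first by rewrite szY.
rewrite -size_filter => lt_h.
exists (take h (unzip1 [seq p <- Y | p.2 == c])); split.
- apply: subseq_trans (take_subseq _ _) _; apply: subseq_trans sY.
  by apply: map_subseq; apply: filter_subseq.
- by rewrite size_takel // size_map ltnW.
exists c => s s_sub; apply: (head_determined_filter hdY).
exact: subseq_trans s_sub (take_subseq _ _).
Qed.

(** * Homogeneous blocks of vertices *)

(** Sending the diagonal to [None] lets one colouring record both the colours
    of edges and the coincidences of vertices: vertices joined by [Some c] are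
    distinct, so disjointness needs no separate bookkeeping. *)
Definition ecol_opt (r : nat) (V : finType) (e : edge_colouring r V) x y :=
  if x == y then None else Some (e x y).

Lemma ecol_optC r (V : finType) (e : edge_colouring r V) x y :
  ecol_opt e x y = ecol_opt e y x.
Proof. by rewrite /ecol_opt eq_sym ecolC. Qed.

Lemma ecol_opt_None r (V : finType) (e : edge_colouring r V) x y :
  ecol_opt e x y = None -> x = y.
Proof. by rewrite /ecol_opt; case: eqP. Qed.

Lemma ecol_opt_Some r (V : finType) (e : edge_colouring r V) x y c :
  ecol_opt e x y = Some c -> x != y /\ e x y = c.
Proof. by rewrite /ecol_opt; case: eqP => // _ [->]. Qed.

Definition mono_inside r (V : finType) (e : edge_colouring r V) t
    (w : 'I_t -> V) :=
  exists c, forall i j, i != j -> ecol_opt e (w i) (w j) = Some c.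

Definition mono_between r (V : finType) (e : edge_colouring r V) t
    (w w' : 'I_t -> V) :=
  exists c, forall i j, ecol_opt e (w i) (w' j) = Some c.

Lemma mono_betweenC r (V : finType) (e : edge_colouring r V) t
    (w w' : 'I_t -> V) : mono_between e w w' -> mono_between e w' w.
Proof. by case=> c wc; exists c => i j; rewrite ecol_optC wc. Qed.

(** The blocks follow each other in [X]; hence a pair of entries of different
    blocks, or an entry together with a whole other block, is a subsequence of
    [X], to which a Ramsey property of [X] applies. *)
Lemma consecutive_blocks r t (I : eqType) (X : seq I) : r * t <= size X ->
  exists T : 'I_r -> t.-tuple I, (forall c, subseq (T c) X) /\
    (forall c d : 'I_r, c < d -> subseq (T c ++ T d) X).
Proof.
move=> szX.
have blockP (c : 'I_r) : size (take t (drop (c * t) X)) == t.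
  rewrite size_takel // size_drop leq_subRL; last first.
    by rewrite (leq_trans _ szX) // leq_mul2r ltnW ?orbT.
  by rewrite -mulSnr (leq_trans _ szX) // leq_mul2r ltn_ord orbT.
exists (fun c => Tuple (blockP c)); split=> [c|c d lt_cd] /=.
  exact: subseq_trans (take_subseq _ _) (drop_subseq _ _).
rewrite -[X in subseq _ X](cat_take_drop (d * t)); apply: cat_subseq.
  rewrite take_drop (subseq_trans (drop_subseq _ _)) //.
  have -> : take (t + c * t) X = take (t + c * t) (take (d * t) X).
    by rewrite take_takel // -mulSn leq_mul2r lt_cd orbT.
  exact: take_subseq.
exact: take_subseq.
Qed.

(** The pairs [x, y] of indices are coloured by the matrix of all colours
    between [u c x] and [u d y]. On a homogeneous set of indices this matrix
    is constant, and none of its entries is [None]: otherwise [u c x] would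
    coincide with both [u d y] and [u d z], where [x], [y], [z] are the first
    three indices; this is why the set has three more elements than the blocks
    use. The blocks themselves, and not only their images, are needed by
    [homogeneous_family], where they inherit a further Ramsey property from
    [X]. *)
Lemma homogeneous_blocks r t : exists m,
  forall (V : finType) (e : edge_colouring r V) (I : eqType) (X : seq I)
    (u : 'I_r -> I -> V),
  uniq X -> m <= size X -> (forall c, injective (u c)) ->
  exists T : 'I_r -> t.-tuple I,
    [/\ forall c, subseq (T c) X,
        forall c d : 'I_r, c < d -> subseq (T c ++ T d) X,
        forall c, mono_inside e (fun i => u c (tnth (T c) i)) &
        forall c d : 'I_r, c != d ->
          mono_between e (fun i => u c (tnth (T c) i))
                         (fun i => u d (tnth (T d) i))].
Proof.
pose K := {ffun 'I_r * 'I_r -> option 'I_r}.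
have [m ramm] := ramsey 2 K (r * t).+3.
exists m => V e I X u uX le_m u_inj.
pose f s : K := [ffun p => if s is [:: x; y] then
                             ecol_opt e (u p.1 x) (u p.2 y) else None].
have [H [sH szH [a fa]]] := ramm I X f le_m.
have uH := subseq_uniq sH uX.
have aE c d x y : subseq [:: x; y] H ->
    ecol_opt e (u c x) (u d y) = a (c, d).
  by move=> /fa <- //; rewrite ffunE.
have aS c d : exists k, a (c, d) = Some k.
  case def_a: (a (c, d)) => [k|]; first by exists k.
  case: H szH uH aE {sH fa} => [|x [|y [|z H]]] //= _ uH aE.
  have := aE c d x y; rewrite /= !eqxx def_a.
  move=> /(_ isT)/ecol_opt_None xy.
  have := aE c d x z; rewrite /= eqxx def_a.
  have [yz|_] := eqVneq z y; first by rewrite yz mem_head andbF in uH.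
  rewrite eqxx sub0seq => /(_ isT)/ecol_opt_None; rewrite xy => /u_inj yz.
  by rewrite yz mem_head andbF in uH.
have [|T [sT sTT]] := @consecutive_blocks r t _ H.
  by rewrite szH -addn3 leq_addr.
exists T; split=> [c|c d lt_cd|c|c d].
- exact: subseq_trans (sT c) sH.
- exact: subseq_trans (sTT c d lt_cd) sH.
- have [k ack] := aS c c; exists k => i j.
  wlog lt_ij : i j / i < j => [wl|_].
    case: (ltngtP i j) => [lt_ij||/val_inj->]; last by rewrite eqxx.
      exact: wl.
    by rewrite eq_sym ecol_optC; apply: wl.
  rewrite -ack; apply: aE; apply: subseq_trans (sT c).
  have nthE := tnth_nth (tnth (T c) i) (T c).
  rewrite (nthE i) (nthE j); apply: subseq_nth2.
  by rewrite lt_ij size_tuple ltn_ord.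
- wlog lt_cd : c d / c < d => [wl|_].
    case: (ltngtP c d) => [lt_cd||/val_inj->]; last by rewrite eqxx.
      exact: wl.
    by rewrite eq_sym => lt_dc ne; apply: mono_betweenC; apply: wl.
  have [k acd] := aS c d; exists k => i j; rewrite -acd; apply: aE.
  apply: subseq_trans (sTT c d lt_cd).
  by rewrite -cat1s cat_subseq // sub1seq mem_tnth.
Qed.

Definition common_nbrs r (V : finType) (e : edge_colouring r V) (c : 'I_r)
    (I : eqType) (u : I -> V) (s : seq I) : {set V} :=
  [set v | all (fun i => ecol_opt e v (u i) == Some c) s].

(** The heart of the proof.  The sets [U_c] of the outline are the images of
    the maps [u c], and [phi (c, s)] is the common colour profile, towards
    all vertices [u d i], of the vertices in the set [B_(c,s)]. *)
Lemma homogeneous_family r t : exists N M,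
  forall (V : finType) (e : edge_colouring r V),
  (forall c, exists u : 'I_N -> V, injective u /\
     forall s, size s = t -> M <= #|common_nbrs e c u s|) ->
  exists a b : 'I_r -> 'I_t -> V,
    [/\ forall c, mono_inside e (a c) /\ mono_inside e (b c),
        forall c d, c != d ->
          mono_between e (a c) (a d) /\ mono_between e (b c) (b d),
        forall c d, mono_between e (a c) (b d) &
        forall c i j, ecol_opt e (a c i) (b c j) = Some c].
Proof.
have [m blocks] := homogeneous_blocks r t.
pose K : finType := {ffun 'I_r * 'I_r -> option 'I_r * option 'I_r}.
have [N ramN] := ramsey t.+1 K m.
pose L : finType := {ffun 'I_r * 'I_N -> option 'I_r}.
exists N, (#|L| * m.+2).+1 => V e /fin_all_exists[u /all_and2[u_inj u_rich]].
have profile (cs : 'I_r * seq 'I_N) : exists phi : L, size cs.2 = t ->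
    exists b : 'I_m.+2 -> V, [/\ injective b,
      forall k d i, ecol_opt e (b k) (u d i) = phi (d, i) &
      forall k i, i \in cs.2 -> ecol_opt e (b k) (u cs.1 i) = Some cs.1].
  case: cs => c s /=; have [szs|/eqP ne_s] := eqVneq (size s) t; last first.
    by exists [ffun=> None] => /ne_s.
  pose g v : L := [ffun p => ecol_opt e v (u p.1 p.2)].
  have [phi lt_phi] := @pigeonhole_set V L g _ m.+2 (u_rich c s szs).
  exists phi => _; have [b b_inj bA] := inj_ord_of_card (ltnW lt_phi).
  exists b; split=> // [k d i|k i s_i]; have := bA k.
    by rewrite inE => /andP[_ /eqP<-]; rewrite ffunE.
  by rewrite !inE => /andP[/allP/(_ i s_i)/eqP].
have [phi phiP] := choice profile.
(* The profile of the tail of s is evaluated at its head, and the profile of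
   its initial segment at its last entry, so that a vertex may precede or
   follow the block whose neighbours it is compared with. *)
pose f s : K := [ffun p : 'I_r * 'I_r => if s is x :: s' then
  (phi (p.2, s') (p.1, x), phi (p.2, belast x s') (p.1, last x s'))
  else (None, None)].
have f_rcons s x p : (f (rcons s x) p).2 = phi (p.2, s) (p.1, x).
  by rewrite ffunE; case: s => //= y s; rewrite belast_rcons last_rcons.
have [H [sH szH [k fk]]] :=
  ramN _ (enum 'I_N) f (eq_leq (esym (size_enum_ord N))).
have uH := subseq_uniq sH (enum_uniq _).
have [|T [sT sTT inT betT]] := blocks V e _ H u uH _ u_inj.
  by rewrite szH.
have /fin_all_exists[b /all_and3[b_inj b_phi b_nbr]] :=
  fun d => phiP (d, tval (T d)) (size_tuple (T d)).
have [|S [_ _ inS betS]] := blocks V e _ _ b (enum_uniq 'I_m.+2) _ b_inj.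
  by rewrite size_enum_ord leqW.
exists (fun c i => u c (tnth (T c) i)), (fun c i => b c (tnth (S c) i)).
split=> [c|c d ne_cd|c d|c i j].
- by split.
- by split; [apply: betT | apply: betS].
- suff [o phi_o] : exists o, forall i,
      phi (d, tval (T d)) (c, tnth (T c) i) = o.
    (* A profile value None would identify two elements of one B_(d,s); this
       is why these sets are given at least two elements. *)
    case: o phi_o => [l|] phi_o.
      by exists l => i j; rewrite ecol_optC b_phi phi_o.
    exists c => i.
    have bE z := ecol_opt_None (etrans (b_phi d z c _) (phi_o i)).
    by have /b_inj := etrans (bE ord0) (esym (bE (lift ord0 ord0))).
  case: (ltngtP c d) => [lt_cd|lt_dc|/val_inj->].
  + exists (k (c, d)).1 => i; rewrite -(fk (tnth (T c) i :: T d)).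
    * by rewrite ffunE.
    * apply: subseq_trans (sTT c d lt_cd).
      by rewrite -cat1s cat_subseq // sub1seq mem_tnth.
    * by rewrite /= size_tuple.
  + exists (k (c, d)).2 => i; rewrite -(fk (rcons (T d) (tnth (T c) i))).
    * by rewrite f_rcons.
    * apply: subseq_trans (sTT d c lt_dc).
      by rewrite -cats1 cat_subseq // sub1seq mem_tnth.
    * by rewrite size_rcons size_tuple.
  + by exists (Some d) => i; rewrite -(b_phi d ord0) b_nbr ?mem_tnth.
- by rewrite ecol_optC b_nbr ?mem_tnth.
Qed.


(** * Dependent random choice *)

(** Chebyshev's sum inequality for the similarly ordered families [d] and
    [d ^ t]; it is the induction step of the power mean inequality below. *)
Lemma leq_sum_mul_expn (V : finType) (d : V -> nat) t :
  (\sum_x d x) * (\sum_x d x ^ t) <= #|V| * \sum_x d x ^ t.+1.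
Proof.
have swap a b : a * b ^ t + b * a ^ t <= a ^ t.+1 + b ^ t.+1.
  wlog le_ab : a b / a <= b => [wl|].
    by case: (leqP a b) => [|/ltnW] /wl //; rewrite addnC [leqRHS]addnC.
  have le_abt : a ^ t <= b ^ t by case: t => // t; rewrite leq_exp2r.
  rewrite !expnS -(subnKC le_abt) !mulnDr -addnA leq_add2l addnC leq_add2l.
  by rewrite leq_mul2r le_ab orbT.
have -> : (\sum_x d x) * (\sum_x d x ^ t) = \sum_x \sum_y d x * d y ^ t.
  exact: big_distrlr.
have -> : #|V| * \sum_x d x ^ t.+1 = \sum_(x : V) \sum_y d y ^ t.+1.
  by rewrite sum_nat_const.
rewrite -leq_double -!addnn [X in _ + X <= _]exchange_big
  [X in _ <= _ + X]exchange_big -!big_split /=.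
apply: leq_sum => x _; rewrite -!big_split /=; apply: leq_sum => y _.
by rewrite [leqRHS]addnC; apply: swap.
Qed.

Lemma expn_sum_leq (V : finType) (d : V -> nat) t :
  (\sum_x d x) ^ t.+1 <= #|V| ^ t * \sum_x d x ^ t.+1.
Proof.
elim: t => [|t IHt]; first by rewrite expn1 expn0 mul1n leq_sum.
rewrite expnS (leq_trans (leq_mul (leqnn _) IHt)) // mulnCA expnSr -mulnA.
by rewrite leq_mul2l leq_sum_mul_expn orbT.
Qed.

(** Double counting replaces the random choice of a tuple [T].  The sum of
    [#|nb T|] over all [T] is the sum of the powers of the degrees.  A tuple
    [S] with fewer than [M] common neighbours lies in [nb T] for fewer than
    [M ^ t.+1] tuples [T], since [S] lies in [nb T] if and only if [T] lies in
    [nb S].  So some [nb T] has at least [N] more elements than it contains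
    bad tuples, and it remains to delete one entry of each bad tuple.
    Tuples with repeated entries are included. *)
Lemma dependent_random_choice (V : finType) (adj : rel V) t M N :
    symmetric adj -> 0 < #|V| ->
    (M ^ t.+1 + N) * #|V| ^ t.+1 <= \sum_x #|[set y | adj x y]| ^ t.+1 ->
  exists2 U : {set V}, N <= #|U| &
    forall S : {ffun 'I_t.+1 -> V}, (forall i, S i \in U) ->
      M <= #|[set v | [forall i, adj v (S i)]]|.
Proof.
move=> adjC V_gt0 le_sum.
pose nb (S : {ffun 'I_t.+1 -> V}) := [set v | [forall i, adj v (S i)]].
pose bad := [set S | #|nb S| < M].
pose badin T := [set S in bad | [forall i, S i \in nb T]].
have sum_nb : \sum_T #|nb T| = \sum_x #|[set y | adj x y]| ^ t.+1.
  under eq_bigr do rewrite -sum1_card.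
  rewrite (exchange_big_dep xpredT) //=; apply: eq_bigr => x _.
  rewrite sum1_card -[in RHS](card_ord t.+1) -card_ffun_on.
  apply: eq_card => T.
  change ((x \in nb T) = (T \in ffun_on [set y | adj x y])).
  by rewrite inE; apply/forallP/ffun_onP => h i; have := h i; rewrite inE.
have sum_badin : \sum_T #|badin T| <= M ^ t.+1 * #|V| ^ t.+1.
  under eq_bigr do rewrite -sum1_card.
  rewrite (exchange_big_dep (mem bad)) => [|T S _] /=; last first.
    by rewrite inE => /andP[].
  apply: (@leq_trans (\sum_(S in bad) M ^ t.+1)); last first.
    rewrite sum_nat_const mulnC leq_mul2l (leq_trans (max_card _)) ?orbT //.
    by rewrite card_ffun card_ord.
  apply: leq_sum => S; rewrite inE => /ltnW le_M.
  apply: (@leq_trans (#|nb S| ^ t.+1)); last by rewrite leq_exp2r.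
  rewrite sum1_card -[X in _ ^ X](card_ord t.+1) -card_ffun_on.
  apply/subset_leq_card/subsetP => T.
  change (S \in badin T -> T \in ffun_on (nb S)); rewrite inE.
  move=> /andP[_ /forallP nbT]; apply/ffun_onP => j; rewrite inE.
  apply/forallP => i; have := nbT i; rewrite inE => /forallP/(_ j).
  by rewrite adjC.
have [T le_T] : exists T, #|badin T| + N <= #|nb T|.
  apply/existsP; apply: contraLR le_sum; rewrite negb_exists -ltnNge.
  move=> /forallP lt_nb; rewrite -sum_nb.
  have card_ffunV : #|{ffun 'I_t.+1 -> V}| = #|V| ^ t.+1.
    by rewrite card_ffun card_ord.
  rewrite -(ltn_add2r (#|V| ^ t.+1)).
  apply: (@leq_ltn_trans (\sum_T #|badin T| + N * #|V| ^ t.+1)); last first.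
    by rewrite mulnDl -addn1 !leq_add // expn_gt0 V_gt0.
  rewrite -card_ffunV mulnC -sum_nat_const -[X in _ + X <= _]muln1.
  rewrite -sum_nat_const -!big_split /=; apply: leq_sum => T _.
  by rewrite addn1 ltnNge lt_nb.
pose R := [set S ord0 | S : {ffun 'I_t.+1 -> V} in badin T].
exists (nb T :\: R) => [|S SU].
  have le_R : #|R| <= #|badin T| by apply: leq_imset_card.
  have := subset_leq_card (subsetIr (nb T) R); rewrite cardsD.
  move=> /leq_trans/(_ le_R) le_I; rewrite leq_subRL; last first.
    exact/subset_leq_card/subsetIl.
  by rewrite (leq_trans _ le_T) // leq_add2r.
rewrite leqNgt; apply/negP => lt_M.
have := SU ord0; rewrite inE => /andP[/negP notR _]; apply: notR.
apply: imset_f; rewrite !inE lt_M; apply/forallP => i.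
by have := SU i; rewrite inE => /andP[].
Qed.

Local Open Scope ring_scope.

(** * From the density hypothesis to the theorem *)

Lemma expn_leq_of_powR (R : realType) D n E t :
  D%:R * n%:R `^ (2 - t.+1%:R^-1) <= E%:R :> R ->
  (D ^ t.+1 * n ^ (2 * t).+1 <= E ^ t.+1)%N.
Proof.
move=> le_E; rewrite -(ler_nat R) natrM !natrX.
apply: le_trans (lerXn2r t.+1 _ _ le_E); rewrite ?nnegrE ?mulr_ge0 ?powR_ge0 //.
rewrite exprMn -[X in _ <= _ * X]powR_mulrn ?powR_ge0 // -powRrM.
suff -> : (2 - t.+1%:R^-1) * t.+1%:R = (2 * t).+1%:R :> R by rewrite powR_mulrn.
rewrite mulrBl mulVf ?pnatr_eq0 //; apply/eqP.
by rewrite subr_eq natr1 -natrM mulnS.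
Qed.

Lemma card_colour_class_leq r (V : finType) (e : edge_colouring r V) c :
  (#|colour_class e c| <= \sum_x #|[set y | ecol_opt e x y == Some c]|)%N.
Proof.
apply: leq_trans (leq_imset_card _ _) _.
under [leqRHS]eq_bigr do rewrite -sum1_card.
rewrite pair_big_dep /= -sum1_card; apply/eq_leq/eq_bigl => -[x y].
by rewrite !inE /= /ecol_opt; case: eqP.
Qed.

(** One vertex of each block represents it in the reduced graph on [I]; its
    vertex colour is the colour inside the block.  Restricting it to an
    inclusion-minimal set of blocks on which all colours appear makes it
    [r]-minimal. *)
Lemma unavoidable_of_family r t (V : finType) (e : edge_colouring r V)
    (I : finType) (w : I -> 'I_t.+1 -> V) :
  (forall p, mono_inside e (w p)) ->
  (forall p q, p != q -> mono_between e (w p) (w q)) ->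
  (forall c, exists p q, p != q /\ ecol_opt e (w p ord0) (w q ord0) = Some c) ->
  exists (W : finType) (h : edge_colouring r W),
    unavoidable t.+1 h /\ contains e h.
Proof.
move=> /fin_all_exists[vc vcE] betE allc.
have ecC p q : e (w p ord0) (w q ord0) = e (w q ord0) (w p ord0).
  exact: ecolC.
pose G := ColouredGraph vc (EdgeColouring ecC).
have GT : `[< has_all_colours G [set: I] >].
  apply/asboolP => c; right.
  have [p [q [ne_pq /ecol_opt_Some[_ pqc]]]] := allc c.
  by exists p, q; rewrite !inE.
have [S /minsetP[/asboolP GS minS] _] :=
  @minset_exists _ (fun A => `[< has_all_colours G A >]) _ GT.
pose X : finType := {x : I | x \in S}.
have ecSC (p q : X) : edges_of G (val p) (val q) = edges_of G (val q) (val p).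
  exact: ecolC.
pose GX := ColouredGraph (vc \o val) (EdgeColouring ecSC).
have appearsX (A : {set X}) c :
    appears_on GX A c <-> appears_on G [set val x | x in A] c.
  split=> [[[x Ax xc]|[x [y [Ax Ay ne_xy xyc]]]]|].
  - by left; exists (val x) => //; apply: imset_f.
  - right; exists (val x), (val y); rewrite !imset_f //; split=> //.
  - case=> [[_ /imsetP[x Ax ->] xc]|]; first by left; exists x.
    case=> _ [_ [/imsetP[x Ax ->] /imsetP[y Ay ->] ne_xy xyc]].
    by right; exists x, y; split=> //; apply: contraNneq ne_xy => ->.
have imX : [set val x | x in [set: X]] = S.
  apply/setP => x; apply/imsetP/idP => [[y _ ->]|Sx]; first exact: valP.
  by exists (Sub x Sx); rewrite ?inE ?SubK.
exists (X * 'I_t.+1)%type, (blowup t.+1 GX); split.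
  exists X, GX; split; last by exists id; split=> //; exists id.
  split=> [c|A]; first by rewrite appearsX imX; apply: GS.
  rewrite properEneq => /andP[/eqP neA _] GA; apply: neA.
  have sA : [set val x | x in A] \subset S.
    by apply/subsetP => _ /imsetP[x _ ->]; apply: valP.
  have eqA := minS [set val x | x in A] _ sA.
  apply: (imset_inj val_inj); rewrite imX eqA //.
  by apply/asboolP => c; rewrite -appearsX; apply: GA.
exists (fun v => w (val v.1) v.2).
have fE u v : u != v ->
    ecol_opt e (w (val u.1) u.2) (w (val v.1) v.2) = Some (blowup t.+1 GX u v).
  case: u v => [p i] [q j] /=; rewrite /blowup_col /= xpair_eqE.
  case: eqVneq => [->|ne_pq] /= ne_ij; first exact: vcE.
  have [k kE] := betE (val p) (val q) ne_pq.
  by rewrite kE; have /ecol_opt_Some[_ <-] := kE ord0 ord0.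
split=> [u v eq_w|u v /fE /ecol_opt_Some[]//].
by apply/eqP/negPn/negP => /fE/ecol_opt_Some[]; rewrite eq_w eqxx.
Qed.

Theorem theorem2p2 (R : realType) (r t : nat) (t_gt0 : (0 < t)%N) :
  exists C : R, 0 < C /\
    exists n0 : nat, forall n : nat, (n0 <= n)%N ->
      forall e : edge_colouring r 'I_n,
        (forall c : 'I_r,
           C * n%:R `^ (2 - t%:R^-1) <= #|colour_class e c|%:R) ->
        exists (W : finType) (h : edge_colouring r W),
          unavoidable t h /\ contains e h.
Proof.
case: t t_gt0 => // t _.
have [N [M family]] := homogeneous_family r t.+1.
(* Dependent random choice needs M ^ t.+1 + N; as D <= D ^ t.+1, the
   successor serves as the constant C and is positive even for N = M = 0. *)
pose D := (M ^ t.+1 + N).+1.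
exists D%:R; split; first by rewrite ltr0n.
exists 1%N => n n_gt0 e dense.
have [c|a [b [inab betab betAB abc]]] := family _ e; last first.
  apply: (@unavoidable_of_family _ _ _ _ _
    (fun p : 'I_r + 'I_r => match p with inl c => a c | inr c => b c end)).
  - by case=> c; have [] := inab c.
  - case=> c [] d ne_cd.
    + by have [] := betab c d ne_cd.
    + exact: betAB.
    + exact/mono_betweenC/betAB.
    + by have [] := betab c d ne_cd.
  - by move=> c; exists (inl c), (inr c).
pose d (x : 'I_n) := #|[set y | ecol_opt e x y == Some c]|.
have le_d : (D * n ^ t.+1 <= \sum_x d x ^ t.+1)%N.
  rewrite -(@leq_pmul2l (n ^ t)) ?expn_gt0 ?n_gt0 //.
  have := expn_sum_leq d t; rewrite card_ord; apply: leq_trans.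
  apply: leq_trans (leq_trans (expn_leq_of_powR (dense c)) _); last first.
    by rewrite leq_exp2r // card_colour_class_leq.
  rewrite mulnCA -expnD addnS addnn -mul2n leq_mul2r.
  by rewrite -[X in (X <= _)%N]expn1 leq_pexp2l ?orbT.
have [|||U le_U U_nbr] := @dependent_random_choice 'I_n
  (fun x y => ecol_opt e x y == Some c) t M N.
- by move=> x y; rewrite ecol_optC.
- by rewrite card_ord.
- by rewrite card_ord (leq_trans _ le_d) // leq_mul2r leqnSn orbT.
have [u u_inj uU] := inj_ord_of_card le_U.
exists u; split=> // s szs.
pose S := [ffun i : 'I_t.+1 => u (tnth (in_tuple s) (cast_ord (esym szs) i))].
apply: leq_trans (U_nbr S _) _ => [i|]; first by rewrite ffunE.
apply/subset_leq_card/subsetP => v; rewrite !inE => /forallP vS.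
apply/allP => i /(tnthP (in_tuple s))[k ->].
by have := vS (cast_ord szs k); rewrite ffunE cast_ordK.
Qed.
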